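(* Let $(W,S)$ be a Weyl group, and let $\mathbf L$ be the minuscule middle order on $W$ induced by a permutation $s_{i_1},\dots,s_{i_r}$ of $S$. Let $\omega=\omega_r\omega_{r-1}\cdots\omega_2\omega_1$ where for all $1\le k\le r$, $\omega_k$ is a reduced word for the minimal-length element of the topmost coset in $W_{\{s_{i_{k+1}},\dots,s_{i_r}\}}\backslash W_{\{s_{i_k},\dots,s_{i_r}\}}$ (i.e. for the longest among the minimal-length coset representatives). Then $\mathbf L$ is equal to the $\omega$-sorting order $\mathbf{Sort}_\omega$.
   Context: $(W,S)$ is a finite Weyl group with root system $\Phi=\Phi^+\sqcup\Phi^-$, simple roots $\alpha_s$ ($s\in S$); $\Phi^+$ is ordered by $\alpha\le\beta$ iff $\beta-\alpha$ is a nonnegative combination of positive roots. A simple root is minuscule if it appears with multiplicity $1$ in the expression of the maximal root of its irreducible component of $\Phi^+$ as a combination of simple roots. For $J\subset S$, $W_J$ is the parabolic subgroup generated by $J$, and ${}^JW$ is the set of minimal-length elements of the cosets in $W_J\backslash W$; every $w\in W$ factors uniquely as $w=w_J\cdot{}^Jw$ with $w_J\in W_J$, ${}^Jw\in{}^JW$. If $J=S\setminus\{s\}$ with $\alpha_s$ minuscule, the right weak order and the Bruhat order coincide on ${}^JW$ and give a distributive lattice. Minuscule middle orders: let $s_{i_1},\dots,s_{i_r}$ be a permutation of $S$ such that for all $1\le k\le r$, $\alpha_{s_{i_k}}$ is a minuscule root of $W_{\{s_{i_k},\dots,s_{i_r}\}}$. The minuscule middle order $(W,\le_{s_{i_1},\dots,s_{i_r}})$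 is defined recursively as the product $(W_J,\le_{s_{i_2},\dots,s_{i_r}})\times{}^JW$ with $J=S\setminus\{s_{i_1}\}$, i.e. $v\le w$ iff $v_J\le_{s_{i_2},\dots,s_{i_r}}w_J$ and ${}^Jv\le{}^Jw$ in ${}^JW$. Sorting order: for a reduced word $\omega$ of the longest element $w_0$ and $w\in W$, $\mathrm{sort}_\omega(w)$ is the set of positions of the lexicographically first (comparing position sets) subword of $\omega$ that is a reduced word for $w$; $v\le w$ in $\mathbf{Sort}_\omega$ iff $\mathrm{sort}_\omega(v)\subset\mathrm{sort}_\omega(w)$. *)

(* Defs.v *)
From HB Require Import structures.
From mathcomp Require Import all_boot all_order all_fingroup all_algebra.
From mathcomp Require Import finmap.

Set Implicit Arguments.
Unset Strict Implicit.
Unset Printing Implicit Defensive.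

Import Order.TTheory GRing.Theory Num.Theory.
Local Open Scope ring_scope.

Section EuclideanReflection.
Variables (R : realFieldType) (n : nat).
Implicit Types a b u v : 'rV[R]_n.

Definition dotv u v : R := (u *m v^T) 0 0.

(* <b, a^vee> = 2 (b, a) / (a, a) *)
Definition pairing b a : R := 2%:R * dotv b a / dotv a a.

Definition reflect_vec a b : 'rV[R]_n := b - pairing b a *: a.

Lemma dotv_gt0 a : a != 0 -> 0 < dotv a a.
Proof.
move=> /rV0Pn[i ai0]; rewrite /dotv mxE (bigD1 i) //= mxE -expr2.
rewrite ltr_pwDl ?exprn_even_gt0 ?ai0 ?orbT //.
by rewrite sumr_ge0 // => j _; rewrite mxE -expr2 sqr_ge0.
Qed.

Lemma reflect_vecK a : a != 0 -> involutive (reflect_vec a).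
Proof.
move=> /dotv_gt0/lt0r_neq0 a0 b; rewrite /reflect_vec.
have dB k : dotv (b - k *: a) a = dotv b a - k * dotv a a.
  by rewrite /dotv mulmxBl -scalemxAl !mxE.
have -> : pairing (b - pairing b a *: a) a = - pairing b a.
  rewrite {1}/pairing dB {1}/pairing divfK // (mulr_natl (dotv b a)) mulr2n opprD addrA subrr add0r.
  by rewrite mulrN mulNr.
by rewrite scaleNr opprK subrK.
Qed.

End EuclideanReflection.

(* Reduced crystallographic root systems in R^n with the standard inner       *)
(* product; the roots are not required to span the ambient space.             *)
Record rootSystem (R : realFieldType) (n : nat) := RootSystem {
  root_fset : {fset 'rV[R]_n};
  root_neq0 : forall a : 'rV[R]_n, a \in root_fset -> a != 0;
  root_reflect : forall a b : 'rV[R]_n, a \in root_fset -> b \in root_fset ->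
    reflect_vec a b \in root_fset;
  root_int : forall a b : 'rV[R]_n, a \in root_fset -> b \in root_fset ->
    exists m : int, pairing b a = m%:~R;
  root_reduced : forall (a : 'rV[R]_n) (c : R),
    a \in root_fset -> c *: a \in root_fset -> c = 1 \/ c = -1
}.

(* A choice of simple roots alpha_s; the index type 'I_r stands for S.        *)
Record simpleSystem (R : realFieldType) (n : nat) (X : rootSystem R n)
    (r : nat) := SimpleSystem {
  simple : 'I_r -> root_fset X;
  simple_free : free [tuple val (simple i) | i < r];
  simple_sign : forall a : root_fset X, exists c : 'I_r -> nat,
    val a = \sum_i (c i)%:R *: val (simple i)
    \/ - val a = \sum_i (c i)%:R *: val (simple i)
}.

Section RootPerm.
Variables (R : realFieldType) (n : nat) (X : rootSystem R n).
Local Notation Phi := (root_fset X).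

Definition reflect_root (a b : Phi) : Phi :=
  [` root_reflect (fsvalP a) (fsvalP b)]%fset.

Lemma reflect_rootK a : involutive (reflect_root a).
Proof.
move=> b; apply: val_inj; rewrite /=.
exact: (reflect_vecK (root_neq0 (fsvalP a))).
Qed.

Definition reflection (a : Phi) : {perm Phi} := perm (inv_inj (reflect_rootK a)).

End RootPerm.

Section Weyl.
Variables (R : realFieldType) (n : nat) (X : rootSystem R n).
Variables (r : nat) (D : simpleSystem X r).
Local Notation Phi := (root_fset X).
Local Notation S := 'I_r.
Local Notation alpha := (simple D).
Implicit Types (s : S) (J K : {set S}) (t om : seq S) (v w : {perm Phi}).

(* The Weyl group is realised as the group of permutations of Phi generated   *)
(* by the simple reflections. MathComp composes permutations from left to     *)
(* right, so this is the opposite of composition of linear maps; inversion    *)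
(* identifies the two Coxeter systems, fixing every simple reflection.        *)
Definition word_prod t : {perm Phi} := (\prod_(s <- t) reflection (alpha s))%g.

Definition weylJ J : {group {perm Phi}} :=
  <<[set reflection (alpha s) | s in J]>>%G.
Definition weyl : {group {perm Phi}} := weylJ [set: S].

Definition has_word w k : bool := [exists t : k.-tuple S, word_prod t == w].

Lemma weyl_has_word w : w \in weyl -> exists k, has_word w k.
Proof.
move=> /gen_prodgP[k [c cS ->]]; exists k.
have cP i : exists s, c i == reflection (alpha s).
  by have /imsetP[s _ ->] := cS i; exists s.
apply/existsP; exists [tuple xchoose (cP i) | i < k]; apply/eqP.
rewrite /word_prod big_tuple; apply: eq_bigr => i _.
by rewrite tnth_mktuple -(eqP (xchooseP (cP i))).
Qed.

(* The length of w with respect to S (and 0, by convention, if w is not in W) *)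
Definition len w : nat :=
  match @idP (w \in weyl) with
  | ReflectT wW => ex_minn (weyl_has_word wW)
  | ReflectF _ => 0%N
  end.

Definition reduced_word t w : bool := (word_prod t == w) && (size t == len w).

Definition longest_element : {perm Phi} :=
  [arg max_(w > 1%g in weyl) len w]%N.

Definition right_weak_le v w : bool := len w == (len v + len (v^-1 * w)%g)%N.

(* Minimal-length elements of the cosets in W_J \ W_K *)
Definition min_reps J K : {set {perm Phi}} :=
  [set u | [exists C in rcosets (weylJ J) (weylJ K),
              (u \in C) && [forall v in C, len u <= len v]%N]].

Definition top_rep J K : {perm Phi} :=
  [arg max_(u > 1%g in min_reps J K) len u]%N.

(* The factors of w = rep_left J K w * rep_right J K w, for w in W_K, with    *)
(* the left factor in W_J and the right factor minimal in its coset W_J w     *)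
Definition rep_right J K w : {perm Phi} :=
  repr ((weylJ J :* w)%g :&: min_reps J K).
Definition rep_left J K w : {perm Phi} := (w * (rep_right J K w)^-1)%g.

Definition pos_roots : {set Phi} :=
  [set a : Phi | [forall s, 0 <= coord [tuple val (alpha i) | i < r] s (val a)]].

Definition parabolic_roots K : {set Phi} :=
  [set a : Phi | val a \in <<[seq val (alpha s) | s <- enum K]>>%VS].

(* b - a is a nonnegative combination of the elements of P *)
Definition root_le (P : {set Phi}) (a b : Phi) : Prop :=
  exists2 c : Phi -> R, forall g, 0 <= c g
    & val b - val a = \sum_(g in P) c g *: val g.

Definition orthogonal_roots (A B : {set Phi}) : Prop :=
  forall a b, a \in A -> b \in B -> dotv (val a) (val b) = 0.

Definition irreducible_roots (A : {set Phi}) : Prop :=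
  A != set0 /\ forall B : {set Phi}, B \subset A ->
    orthogonal_roots B (A :\: B) -> B = set0 \/ B = A.

Definition irreducible_component (A B : {set Phi}) : Prop :=
  [/\ A \subset B, irreducible_roots A & orthogonal_roots A (B :\: A)].

Definition maximal_root (P : {set Phi}) (theta : Phi) : Prop :=
  theta \in P /\ forall a, a \in P -> root_le P a theta.

(* alpha_s is a minuscule root of W_K *)
Definition minuscule K s : Prop :=
  exists (A : {set Phi}) (theta : Phi),
    [/\ irreducible_component A (parabolic_roots K), alpha s \in A,
        maximal_root (A :&: pos_roots) theta
      & coord [tuple val (alpha i) | i < r] s (val theta) = 1].

(* middle_le [:: s_1; ...; s_r] is the middle order on W_{s_1, ..., s_r}      *)
Fixpoint middle_le (p : seq S) v w : bool :=
  if p is _ :: q then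
    let J := [set s in q] in let K := [set s in p] in
    middle_le q (rep_left J K v) (rep_left J K w)
    && right_weak_le (rep_right J K v) (rep_right J K w)
  else v == w.

Definition subword om (P : {set 'I_(size om)}) : seq S :=
  [seq tnth (in_tuple om) i | i <- enum P].

(* enum P lists P increasingly; position sets are compared lexicographically. *)
(* The default set0 is irrelevant when om has a reduced subword for w.        *)
Definition sorting_set om w : {set 'I_(size om)} :=
  [arg min_(P < set0 | reduced_word (subword P) w)
     (enum P : seqlexi 'I_(size om))]%O.

Definition sorting_le om v w : bool := sorting_set om v \subset sorting_set om w.

End Weyl.

(* Main.v *)
(* An element w of W is determined by its inversion set [inv_set w] (the
   positive roots made negative by w); its length is the cardinality of this
   set, and right weak order is inclusion of inversion sets.  If a maximal parabolic W_J of W_K is minuscule,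
   the inversion sets of minimal coset representatives consist of positive
   roots of W_K outside W_J, and any two such distinct roots are orthogonal or
   differ by a root of W_J.  Reading a reduced word of the top representative
   from left to right enumerates all these roots, and the greedy (that is,
   lexicographically first) subword for a representative x picks exactly the
   positions whose root lies in [inv_set x]; hence inclusion of sorting sets is
   inclusion of inversion sets.  For the full word, the greedy subword for
   w = u x with u in W_J is the greedy one for u followed by the one for x, so
   the sorting order splits as the product defining the middle order. *)
Require Import Defs.
From HB Require Import structures.
From mathcomp Require Import all_boot all_order all_fingroup all_algebra.
From mathcomp Require Import finmap ring lra.

Set Implicit Arguments.
Unset Strict Implicit.
Unset Printing Implicit Defensive.

Import Order.TTheory GRing.Theory Num.Theory.

(** * Roots and simple reflections *)

Section Roots.
Local Open Scope ring_scope.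
Variables (R : realFieldType) (n : nat) (X : rootSystem R n).
Variables (r : nat) (D : simpleSystem X r).
Local Notation Phi := (root_fset X).
Local Notation alpha := (simple D).
Local Notation base := [tuple val (alpha i) | i < r].
Local Notation pos := (pos_roots D).
Local Notation refl s := (reflection (alpha s)).
Implicit Types (a b : Phi) (s t : 'I_r) (w : {perm Phi}).

Definition root_coord s a : R := coord base s (val a).
Local Notation co := root_coord.

(** Encoded as a reflection so that membership of [- val a] in [Phi] comes for free. *)
Definition neg_root a : Phi := reflect_root a a.

Lemma dotvC (u v : 'rV[R]_n) : dotv u v = dotv v u.
Proof.
by rewrite /dotv -[in RHS](trmxK v) -trmx_mul [RHS]mxE.
Qed.

Lemma dotvBl (u v x : 'rV[R]_n) : dotv (u - v) x = dotv u x - dotv v x.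
Proof. by rewrite /dotv mulmxBl !mxE. Qed.

Lemma dotvZl c (u v : 'rV[R]_n) : dotv (c *: u) v = c * dotv u v.
Proof. by rewrite /dotv -scalemxAl !mxE. Qed.

Lemma dotvDl (u v x : 'rV[R]_n) : dotv (u + v) x = dotv u x + dotv v x.
Proof. by rewrite /dotv mulmxDl !mxE. Qed.

Lemma dotvBr (u v x : 'rV[R]_n) : dotv x (u - v) = dotv x u - dotv x v.
Proof. by rewrite !(dotvC x) dotvBl. Qed.

Lemma dotvZr c (u v : 'rV[R]_n) : dotv v (c *: u) = c * dotv v u.
Proof. by rewrite !(dotvC v) dotvZl. Qed.

Lemma dotv_suml (I : finType) (P : pred I) (F : I -> 'rV[R]_n) (u : 'rV[R]_n) :
  dotv (\sum_(i | P i) F i) u = \sum_(i | P i) dotv (F i) u.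
Proof. by rewrite /dotv mulmx_suml summxE. Qed.

Lemma dotv_root_neq0 a : dotv (val a) (val a) != 0.
Proof. by rewrite gt_eqF // dotv_gt0 // (root_neq0 (fsvalP a)). Qed.

Lemma pairing_self a : pairing (val a) (val a) = 2%:R.
Proof. by rewrite /pairing mulfK // dotv_root_neq0. Qed.

Lemma val_neg_root a : val (neg_root a) = - val a.
Proof.
by rewrite /= /reflect_vec pairing_self scaler_nat mulr2n opprD addrA subrr add0r.
Qed.

Lemma neg_rootK : involutive neg_root.
Proof. by move=> a; apply: val_inj; rewrite !val_neg_root opprK. Qed.

Lemma val_reflection a b :
  val (reflection a b) = val b - pairing (val b) (val a) *: val a.
Proof. by rewrite permE. Qed.

Lemma reflection_self a : reflection a a = neg_root a.
Proof. by rewrite permE. Qed.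

Lemma reflectionK a : involutive (reflection a).
Proof. by move=> b; rewrite !permE reflect_rootK. Qed.

Lemma reflection_invol a : (reflection a * reflection a)%g = 1%g.
Proof. by apply/permP => b; rewrite permM reflectionK perm1. Qed.

Lemma reflection_dotv a b c :
  dotv (val (reflection a b)) (val (reflection a c)) = dotv (val b) (val c).
Proof.
rewrite !val_reflection dotvBl !dotvBr !dotvZl !dotvZr /pairing.
have a0 := dotv_root_neq0 a; rewrite (dotvC (val a) (val c)).
by field.
Qed.

Lemma reflection_fix a b : dotv (val b) (val a) = 0 -> reflection a b = b.
Proof.
move=> ba0; apply: val_inj; rewrite val_reflection /pairing ba0.
by rewrite mulr0 mul0r scale0r subr0.
Qed.

Lemma base_nth s : base`_s = val (alpha s).
Proof. by rewrite -(tnth_nth 0) tnth_mktuple. Qed.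

Lemma co_simple s t : co s (alpha t) = (s == t)%:R.
Proof. by rewrite /co -base_nth coord_free ?simple_free // eq_sym. Qed.

Lemma co_sum s (c : 'I_r -> R) :
  coord base s (\sum_i c i *: val (alpha i)) = c s.
Proof.
rewrite linear_sum (bigD1 s) //= big1 ?addr0 => [|t ts].
  by rewrite linearZ /= -/(co _ _) co_simple eqxx mulr1.
by rewrite linearZ /= -/(co _ _) co_simple eq_sym (negPf ts) mulr0.
Qed.

Lemma co_expand a : val a = \sum_s co s a *: val (alpha s).
Proof.
have [c [ca|ca]] := simple_sign D a.
  by rewrite {1}ca; apply: eq_bigr => s _; rewrite /co ca co_sum.
rewrite -[val a]opprK {1}ca -sumrN; apply: eq_bigr => s _.
by rewrite /co -[val a]opprK linearN ca /= co_sum scaleNr.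
Qed.

Lemma co_neg s a : co s (neg_root a) = - co s a.
Proof. by rewrite /co val_neg_root linearN. Qed.

Lemma co_reflection s a b :
  co s (reflection a b) = co s b - pairing (val b) (val a) * co s a.
Proof. by rewrite /co val_reflection linearB linearZ. Qed.

Lemma posP a : reflect (forall s, 0 <= co s a) (a \in pos).
Proof. by rewrite inE; apply: forallP. Qed.

Lemma pos_or_neg a : (a \in pos) || (neg_root a \in pos).
Proof.
have [c [ca|ca]] := simple_sign D a; apply/orP; [left|right].
  by apply/posP => s; rewrite /co ca co_sum.
by apply/posP => s; rewrite /co val_neg_root ca co_sum.
Qed.

Lemma co_nat s a : a \in pos -> exists k : nat, co s a = k%:R.
Proof.
move=> /posP/(_ s); have [c [ca|ca]] := simple_sign D a.
  by exists (c s); rewrite /co ca co_sum.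
have -> : co s a = - (c s)%:R.
  by rewrite /co -[val a]opprK linearN ca /= co_sum.
rewrite oppr_ge0 => c0; exists 0%N.
by apply/eqP; rewrite oppr_eq0 eq_le c0 ler0n.
Qed.

Lemma pos_neg a : (neg_root a \in pos) = (a \notin pos).
Proof.
have := pos_or_neg a; case: (boolP (a \in pos)) => //= /posP ap _.
apply/negP => /posP an; have := root_neq0 (fsvalP a); case/negP.
rewrite (co_expand a) big1 // => s _; apply/eqP; rewrite scaler_eq0.
by rewrite eq_le ap -oppr_ge0 -co_neg an.
Qed.

(** The coordinates of a root never have opposite signs, so a single strictly positive one settles
    positivity. *)
Lemma pos_of_co s a : 0 < co s a -> a \in pos.
Proof.
move=> sa; apply/negPn; rewrite -pos_neg; apply/negP => /posP/(_ s).
by rewrite co_neg oppr_ge0 leNgt sa.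
Qed.

Lemma pos_simple s : alpha s \in pos.
Proof. by apply: (@pos_of_co s); rewrite co_simple eqxx. Qed.

(** [refl s] alters only the coordinate at [s]. As the root system is reduced, a positive root other
    than [alpha s] has another nonzero coordinate, which survives and stays positive. *)
Lemma pos_reflection s a :
  a \in pos -> a != alpha s -> refl s a \in pos.
Proof.
move=> ap aN; have [/existsP[t /andP[ts ta]]|] :=
    boolP [exists t, (t != s) && (co t a != 0)].
  apply: (@pos_of_co t); rewrite co_reflection co_simple (negPf ts) mulr0 subr0.
  by rewrite lt_def ta; apply/posP.
rewrite negb_exists => /forallP a0.
have aE : val a = co s a *: val (alpha s).
  rewrite {1}co_expand (bigD1 s) //= big1 ?addr0 // => t ts.
  by have := a0 t; rewrite ts /= negbK => /eqP->; rewrite scale0r.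
have := fsvalP a; rewrite [fsval a]aE => /(root_reduced (fsvalP (alpha s)))[] c.
  by case/eqP: aN; apply: val_inj; rewrite aE c scale1r.
by have /posP/(_ s) := ap; rewrite c oppr_ge0 ler10.
Qed.

End Roots.

(** * Length and inversion sets *)

Section Length.
Local Open Scope ring_scope.
Variables (R : realFieldType) (n : nat) (X : rootSystem R n).
Variables (r : nat) (D : simpleSystem X r).
Local Notation Phi := (root_fset X).
Local Notation alpha := (simple D).
Local Notation pos := (pos_roots D).
Local Notation refl s := (reflection (alpha s)).
Local Notation neg := (@neg_root R n X).
Implicit Types (a b : Phi) (s u : 'I_r) (t : seq 'I_r) (w v x : {perm Phi}).

Lemma word_prod0 : word_prod D [::] = 1%g.
Proof. exact: big_nil. Qed.

Lemma word_prod_cons s t : word_prod D (s :: t) = (refl s * word_prod D t)%g.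
Proof. exact: big_cons. Qed.

Lemma word_prod_cat t1 t2 :
  word_prod D (t1 ++ t2) = (word_prod D t1 * word_prod D t2)%g.
Proof. exact: big_cat. Qed.

Lemma refl_weylJ (J : {set 'I_r}) s : s \in J -> refl s \in weylJ D J.
Proof. by move=> sJ; apply/mem_gen/imset_f. Qed.

Lemma word_weylJ (J : {set 'I_r}) t :
  all (mem J) t -> word_prod D t \in weylJ D J.
Proof.
elim: t => [|s t IH] /=; first by rewrite word_prod0 group1.
by case/andP=> sJ /IH; rewrite word_prod_cons => /(groupM (refl_weylJ sJ)).
Qed.

Lemma weylJ_word (J : {set 'I_r}) w :
  w \in weylJ D J -> exists2 t, all (mem J) t & word_prod D t = w.
Proof.
move=> /gen_prodgP[k [c cJ ->]]; elim: k c cJ => [|k IH] c cJ.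
  by exists [::] => //; rewrite big_ord0 word_prod0.
have /imsetP[s sJ cs] := cJ ord0.
have [t tJ tE] := IH (fun i => c (lift ord0 i)) (fun i => cJ _).
exists (s :: t); rewrite /= ?sJ //.
by rewrite word_prod_cons big_ord_recl tE cs.
Qed.

Lemma weylJS (J K : {set 'I_r}) : J \subset K -> weylJ D J \subset weylJ D K.
Proof. by move=> JK; apply/genS/imsetS. Qed.

Lemma weylJ_weyl (J : {set 'I_r}) : weylJ D J \subset weyl D.
Proof. exact/weylJS/subsetT. Qed.

Lemma word_weyl t : word_prod D t \in weyl D.
Proof. by apply: word_weylJ; apply/allP => s _; rewrite inE. Qed.

Lemma weyl_word w : w \in weyl D -> exists t, word_prod D t = w.
Proof. by case/weylJ_word => t _; exists t. Qed.

(** Elements of [weyl D] are mere permutations of [Phi]; the matrix gives back linearity, needed for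
    negatives, sums and expansions in simple roots. *)
Lemma weyl_linear w :
  w \in weyl D -> exists M : 'M[R]_n, forall a, val (w a) = val a *m M.
Proof.
case/weyl_word => t <- {w}; elim: t => [|s t [M IH]].
  by exists 1%:M => a; rewrite word_prod0 perm1 mulmx1.
exists ((1%:M - (2%:R / dotv (val (alpha s)) (val (alpha s))) *:
         ((val (alpha s))^T *m val (alpha s))) *m M) => a.
rewrite word_prod_cons permM IH mulmxA; congr (_ *m _).
rewrite val_reflection mulmxBr mulmx1 -scalemxAr mulmxA.
by rewrite [_ *m _^T]mx11_scalar mul_scalar_mx scalerA /pairing mulrAC.
Qed.

Lemma weyl_dotv w a b : w \in weyl D ->
  dotv (val (w a)) (val (w b)) = dotv (val a) (val b).
Proof.
case/weyl_word => t <- {w}; elim: t a b => [|s t IH] a b.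
  by rewrite word_prod0 !perm1.
by rewrite word_prod_cons !permM IH reflection_dotv.
Qed.

Lemma weyl_neg w a : w \in weyl D -> w (neg a) = neg (w a).
Proof.
case/weyl_linear => M wM; apply: val_inj.
by rewrite val_neg_root !wM val_neg_root mulNmx.
Qed.

Lemma reflection_conj w a : w \in weyl D ->
  (reflection a * w = w * reflection (w a))%g.
Proof.
move=> wW; have [M wM] := weyl_linear wW.
apply/permP => b; rewrite !permM; apply: val_inj.
rewrite wM !val_reflection mulmxBl -scalemxAl -!wM /pairing.
by rewrite !weyl_dotv.
Qed.

Definition inv_set w : {set Phi} := [set a in pos | w a \notin pos].

Lemma in_inv w a : (a \in inv_set w) = (a \in pos) && (w a \notin pos).
Proof. by rewrite in_set. Qed.

Lemma inv_setP w a : reflect (a \in pos /\ w a \notin pos) (a \in inv_set w).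
Proof. by rewrite in_inv; apply: andP. Qed.

Lemma inv_set1 : inv_set 1%g = set0.
Proof. by apply/setP => a; rewrite in_inv perm1 andbN in_set0. Qed.

(** [refl s] permutes the positive roots other than [alpha s], so [alpha s] is the only new
    inversion; the others are transported. *)
Lemma inv_set_refl_mul s w : w \in weyl D -> w (alpha s) \in pos ->
  inv_set (refl s * w)%g = alpha s |: (refl s @: inv_set w).
Proof.
move=> wW ws; apply/setP => a; rewrite in_inv in_setU1 permM.
have [->|a1] /= := eqVneq a (alpha s).
  by rewrite pos_simple reflection_self weyl_neg // pos_neg ws.
have -> : (a \in refl s @: inv_set w) = (refl s a \in inv_set w).
  by rewrite -{1}(reflectionK (alpha s) a) mem_imset //; apply: perm_inj.
rewrite in_inv; case: (boolP (a \in pos)) => ap /=; first by rewrite pos_reflection.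
case: (boolP (refl s a \in pos)) => //= rp; symmetry; apply/negbTE.
rewrite negbK; case: (eqVneq (refl s a) (alpha s)) => [-> //|ra].
by case/negP: ap; rewrite -(reflectionK (alpha s) a) pos_reflection.
Qed.

Lemma card_inv_refl_mul s w : w \in weyl D -> w (alpha s) \in pos ->
  #|inv_set (refl s * w)%g| = #|inv_set w|.+1.
Proof.
move=> wW ws; rewrite inv_set_refl_mul // cardsU1 card_imset; last exact: perm_inj.
(* The preimage of [alpha s] under [refl s] is [neg (alpha s)], which is not positive, so the union
   is disjoint. *)
case: imsetP => // -[a /inv_setP[ap _] aE]; have := pos_simple D s.
have -> : alpha s = neg a.
  by rewrite -(reflectionK (alpha s) a) -aE reflection_self neg_rootK.
by rewrite pos_neg ap.
Qed.

(** The exchange condition. Follow [a] through the word: the deleted letter is the one met when the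
    root has become the simple root of that letter, and [reflection_conj] carries the reflection up
    to it. *)
Lemma root_exchange t a : a \in pos -> word_prod D t a \notin pos ->
  exists t1 u t2, t = t1 ++ u :: t2 /\
    (reflection a * word_prod D t = word_prod D (t1 ++ t2))%g.
Proof.
elim: t a => [|u t IH] a ap; first by rewrite word_prod0 perm1 ap.
have [->|au] := eqVneq a (alpha u) => tp.
  by exists [::], u, t; rewrite word_prod_cons mulgA reflection_invol mul1g.
have /IH := pos_reflection ap au; rewrite word_prod_cons permM in tp *.
case/(_ tp) => t1 [u' [t2 [-> E]]].
exists (u :: t1), u', t2; split=> //; rewrite mulgA.
have uW : refl u \in weyl D by apply: refl_weylJ; rewrite inE.
by rewrite reflection_conj // -mulgA E -word_prod_cons.
Qed.

Lemma len_word w : w \in weyl D -> exists2 t, word_prod D t = w & size t = len D w.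
Proof.
move=> wW; rewrite /len; case: {-}_ / idP => // wW'.
by case: ex_minnP => k /existsP[t /eqP tw] _; exists t => //; rewrite size_tuple.
Qed.

Lemma len_le t : (len D (word_prod D t) <= size t)%N.
Proof.
rewrite /len; case: {-}_ / idP => // wW'.
case: ex_minnP => k _; apply.
by apply/existsP; exists (in_tuple t).
Qed.

(** The tail of a shortest word is itself shortest and keeps the simple root of the first letter
    positive, so each letter adds exactly one inversion. *)
Lemma len_inv w : w \in weyl D -> len D w = #|inv_set w|.
Proof.
move: {2}(len D w) (leqnn (len D w)) => k; elim: k w => [|k IH] w.
  rewrite leqn0 => /eqP l0 /len_word[t tw]; rewrite l0 => /size0nil t0.
  by rewrite -tw t0 word_prod0 inv_set1 cards0.
move=> lk wW; have [[|s t] tw ts] := len_word wW.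
  by rewrite -ts -tw word_prod0 inv_set1 cards0.
have lt : len D (word_prod D t) = size t.
  apply/eqP; rewrite eqn_leq len_le /=.
  have [t' t'w <-] := len_word (word_weyl t).
  by rewrite -ltnS -/(size (s :: t)) ts -tw word_prod_cons -t'w -word_prod_cons len_le.
(* Otherwise exchange deletes a letter of [t] and writes [w] with two letters fewer than its
   length. *)
have sp : word_prod D t (alpha s) \in pos.
  apply: contraT => /(root_exchange (pos_simple D s))[t1 [u [t2 [tE E]]]].
  have := len_le (t1 ++ t2); rewrite -E -word_prod_cons tw -ts tE /=.
  by rewrite !size_cat /= ltnNge addnS leqnSn.
rewrite -ts -tw word_prod_cons card_inv_refl_mul ?word_weyl //= -lt.
by rewrite IH ?word_weyl // lt -ltnS -/(size (s :: t)) ts.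
Qed.

Lemma len1 : len D 1%g = 0%N.
Proof. by rewrite len_inv ?group1 // inv_set1 cards0. Qed.

Lemma len_eq0 w : w \in weyl D -> len D w = 0%N -> w = 1%g.
Proof. by case/len_word => t tw <- /size0nil t0; rewrite -tw t0 word_prod0. Qed.

Lemma len_refl_mul_pos s w : w \in weyl D -> w (alpha s) \in pos ->
  len D (refl s * w)%g = (len D w).+1.
Proof.
move=> wW ws; rewrite !len_inv ?card_inv_refl_mul // groupM //.
by apply: refl_weylJ; rewrite inE.
Qed.

Lemma len_refl_mul_neg s w : w \in weyl D -> w (alpha s) \notin pos ->
  len D w = (len D (refl s * w)%g).+1.
Proof.
move=> wW ws; have sW : refl s \in weyl D by apply: refl_weylJ; rewrite inE.
rewrite -(@len_refl_mul_pos s) ?groupM // ?mulgA ?reflection_invol ?mul1g //.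
by rewrite permM reflection_self weyl_neg // pos_neg.
Qed.

End Length.

(** * Weak order and parabolic cosets *)

Section Parabolic.
Local Open Scope ring_scope.
Variables (R : realFieldType) (n : nat) (X : rootSystem R n).
Variables (r : nat) (D : simpleSystem X r).
Local Notation Phi := (root_fset X).
Local Notation alpha := (simple D).
Local Notation pos := (pos_roots D).
Local Notation par := (parabolic_roots D).
Local Notation refl s := (reflection (alpha s)).
Local Notation co := (root_coord D).
Local Notation neg := (@neg_root R n X).
Local Notation inv := (inv_set D).
Local Notation W := (weyl D).
Implicit Types (a b : Phi) (s : 'I_r) (t : seq 'I_r) (w v x u : {perm Phi}).
Implicit Types (J K : {set 'I_r}).

(** The image of [inv w :\: inv v] under [v] always lies in [inv (v^-1 * w)]. Comparing
    cardinalities turns additivity of lengths into inclusion; conversely, under inclusion this image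
    is everything. *)
Lemma right_weak_leE v w : v \in W -> w \in W ->
  right_weak_le D v w = (inv v \subset inv w).
Proof.
move=> vW wW; have cW : (v^-1 * w)%g \in W by rewrite groupM ?groupV.
rewrite /right_weak_le !len_inv // -(cardsID (inv v) (inv w)).
rewrite -(card_imset (_ :\: _) (@perm_inj _ v)).
set B := v @: _; have BS : B \subset inv (v^-1 * w)%g.
  apply/subsetP => _ /imsetP[a /setDP[/inv_setP[ap wa] va] ->].
  by move: va; rewrite !in_inv ap /= negbK permM permK => ->.
apply/idP/idP => [/eqP E|vw].
  apply/setIidPr/eqP; rewrite eqEcard subsetIr -(leq_add2r #|B|) E leq_add2l.
  exact: subset_leq_card.
rewrite (setIidPr vw) eqn_add2l eqn_leq subset_leq_card //=.
apply/subset_leq_card/subsetP => b; rewrite in_inv permM => /andP[bp wb].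
have [vbp|vbn] := boolP ((v^-1)%g b \in pos).
  by rewrite -[b](permKV v) imset_f // inE !in_inv permKV vbp bp wb.
have : neg ((v^-1)%g b) \in inv v.
  by rewrite in_inv pos_neg vbn (weyl_neg _ vW) permKV pos_neg bp.
move/(subsetP vw); rewrite in_inv (weyl_neg _ wW) => /andP[_].
by rewrite pos_neg (negPf wb).
Qed.

Lemma len_inv_sub v w : v \in W -> w \in W -> inv v \subset inv w ->
  len D w = (len D v + len D (v^-1 * w)%g)%N.
Proof. by move=> vW wW; rewrite -right_weak_leE // => /eqP. Qed.

(** Inclusion both ways makes the lengths add both ways, which forces [v^-1 * w] to have length
    0. *)
Lemma inv_set_inj : {in W &, injective inv}.
Proof.
move=> v w vW wW E; have vw := len_inv_sub vW wW; have wv := len_inv_sub wW vW.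
have := vw; rewrite E subxx => /(_ isT); rewrite wv ?E ?subxx // -addnA => /eqP.
rewrite -[X in X == _]addn0 eqn_add2l eq_sym addn_eq0 => /andP[_ /eqP l0].
have /(congr1 (mulg v)) : (v^-1 * w)%g = 1%g.
  by apply: (@len_eq0 _ _ _ _ D); rewrite ?groupM ?groupV.
by rewrite mulKVg mulg1 => ->.
Qed.

Lemma inv_set_mul_refl w s : w \in W -> (w^-1)%g (alpha s) \in pos ->
  inv (w * refl s)%g = (w^-1)%g (alpha s) |: inv w.
Proof.
move=> wW ws; apply/setP => a; rewrite in_setU1 !in_inv permM.
have [->|a1] /= := eqVneq a ((w^-1)%g (alpha s)).
  by rewrite ws permKV reflection_self pos_neg pos_simple.
have {}a1 : w a != alpha s by rewrite -(inj_eq (@perm_inj _ w^-1%g)) permK.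
case: (boolP (a \in pos)) => //= ap.
case: (boolP (w a \in pos)) => wa /=; first by rewrite pos_reflection.
apply/negP => sw.
(* The only inversion that could be lost has [w a = neg (alpha s)], which would make
   [w^-1 (alpha s)] negative. *)
have [E|/(pos_reflection sw)] := eqVneq (refl s (w a)) (alpha s); last first.
  by rewrite reflectionK (negPf wa).
have wE : w a = neg (alpha s).
  by rewrite -(reflectionK (alpha s) (w a)) E reflection_self.
by move: ws; rewrite -[alpha s]neg_rootK -wE (weyl_neg _ (groupVr wW)) permK pos_neg ap.
Qed.

Lemma len_mul_refl w s : w \in W -> (w^-1)%g (alpha s) \in pos ->
  len D (w * refl s)%g = (len D w).+1.
Proof.
move=> wW ws; rewrite !len_inv ?groupM // ?refl_weylJ ?inE //.
by rewrite inv_set_mul_refl // cardsU1 in_inv permKV pos_simple andbF.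
Qed.

Lemma len_mul_refl_neg w s : w \in W -> (w^-1)%g (alpha s) \notin pos ->
  len D w = (len D (w * refl s)%g).+1.
Proof.
move=> wW ws; have sW : refl s \in W by rewrite refl_weylJ ?inE.
rewrite -(@len_mul_refl _ s) ?groupM // -?mulgA ?reflection_invol ?mulg1 //.
rewrite invMg permM; have -> : ((refl s)^-1)%g (alpha s) = neg (alpha s).
  by apply: (@perm_inj _ (refl s)); rewrite permKV -reflection_self reflectionK.
by rewrite (weyl_neg _ (groupVr wW)) pos_neg.
Qed.

Lemma parP K a : reflect (forall s, s \notin K -> co s a = 0) (a \in par K).
Proof.
rewrite in_set; apply: (iffP idP) => [aK s sK|a0].
  rewrite /root_coord (coord_span aK) linear_sum big1 // => i _ /=.
  rewrite linearZ /=.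
  have /mapP[j jK ->] : [seq val (alpha s) | s <- enum K]`_i \in
      [seq val (alpha s) | s <- enum K].
    by apply: mem_nth; rewrite size_map -cardE.
  rewrite -/(co _ _) co_simple.
  have /negPf-> : s != j by apply: contraNneq sK => ->; rewrite -mem_enum.
  by rewrite mulr0.
rewrite (co_expand D a) memv_suml // => s _; have [sK|/a0->] := boolP (s \in K).
  by rewrite memvZ // memv_span //; apply/mapP; exists s; rewrite ?mem_enum.
by rewrite scale0r mem0v.
Qed.

Lemma par_simple K s : s \in K -> alpha s \in par K.
Proof.
by move=> sK; apply/parP => t tK; rewrite co_simple; case: eqP sK tK => // -> ->.
Qed.

Lemma par_simpleE K s : (alpha s \in par K) = (s \in K).
Proof.
apply/idP/idP => [/parP sK|]; last exact: par_simple.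
by apply: contraT => /sK/eqP; rewrite co_simple eqxx oner_eq0.
Qed.

Lemma par_setT a : a \in par setT.
Proof. by apply/parP => s; rewrite inE. Qed.

Lemma par_set0 a : a \notin par set0.
Proof.
apply/parP => a0; have := root_neq0 (fsvalP a); case/negP.
by rewrite [fsval a](co_expand D a) big1 // => s _; rewrite a0 ?inE // scale0r.
Qed.

Lemma parS J K : J \subset K -> par J \subset par K.
Proof.
move=> /subsetP JK; apply/subsetP => a /parP aJ; apply/parP => s sK; apply: aJ.
by apply: contra sK => /JK.
Qed.

Lemma par_neg K a : (neg a \in par K) = (a \in par K).
Proof.
suff H b : b \in par K -> neg b \in par K.
  by apply/idP/idP => /H //; rewrite neg_rootK.
by move=> /parP bK; apply/parP => s /bK; rewrite co_neg => ->; rewrite oppr0.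
Qed.

Lemma co_weylJ K w s a : w \in weylJ D K -> s \notin K -> co s (w a) = co s a.
Proof.
case/weylJ_word => t tK <- {w} sK; elim: t a tK => [|u t IH] a /=.
  by rewrite word_prod0 perm1.
case/andP=> uK /IH E; rewrite word_prod_cons permM E co_reflection co_simple.
by case: eqP sK uK => [-> /negPf-> //|]; rewrite mulr0 subr0.
Qed.

Lemma par_weylJ K w a : w \in weylJ D K -> (w a \in par K) = (a \in par K).
Proof.
by move=> wK; apply/parP/parP => H s sK; have := H s sK; rewrite (co_weylJ _ wK).
Qed.

(** A root outside [par K] has a nonzero coordinate off [K]; it decides the sign and is fixed by the
    group of [K]. *)
Lemma pos_weylJ K w a : w \in weylJ D K -> a \notin par K ->
  (w a \in pos) = (a \in pos).
Proof.
have H v b : v \in weylJ D K -> b \notin par K -> b \in pos -> v b \in pos.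
  move=> vK bK /posP bp; have : [exists s, (s \notin K) && (co s b != 0)].
    apply: contraR bK; rewrite negb_exists => /forallP b0; apply/parP => s sK.
    by have := b0 s; rewrite sK negbK => /eqP.
  case/existsP => s /andP[sK s0]; apply: (@pos_of_co _ _ _ _ _ s).
  by rewrite (co_weylJ _ vK) // lt_def s0 bp.
move=> wK aK; apply/idP/idP; last exact: H.
by move/(H w^-1%g); rewrite permK groupV par_weylJ // => ->.
Qed.

Lemma inv_weylJ K w : w \in weylJ D K -> inv w \subset par K.
Proof.
move=> wK; apply/subsetP => a /inv_setP[ap]; apply: contraR => aK.
by rewrite (pos_weylJ wK).
Qed.

Lemma weylJ_W K w : w \in weylJ D K -> w \in W.
Proof. exact/subsetP/weylJ_weyl. Qed.

Lemma co_weyl w s a : w \in W ->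
  co s (w a) = \sum_j co j a * co s (w (alpha j)).
Proof.
case/weyl_linear => M wM; rewrite /root_coord wM {1}(co_expand D a).
rewrite mulmx_suml linear_sum; apply: eq_bigr => j _.
by rewrite -scalemxAl -wM linearZ.
Qed.

(** The root form of minimality in the coset [W_J x], as [min_repsP] shows. *)
Definition pos_on J x := forall a, a \in par J -> a \in pos -> x a \in pos.

Lemma pos_on_simple J x : x \in W ->
  (forall s, s \in J -> x (alpha s) \in pos) -> pos_on J x.
Proof.
move=> xW xJ a /parP aJ /posP ap; apply/posP => s; rewrite co_weyl //.
apply: sumr_ge0 => j _; have [jJ|/aJ->] := boolP (j \in J); last by rewrite mul0r.
by rewrite mulr_ge0 //; have /posP := xJ j jJ.
Qed.

Lemma pos_onE J x a : x \in W -> pos_on J x -> a \in par J ->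
  (x a \in pos) = (a \in pos).
Proof.
move=> xW xJ aJ; apply/idP/idP; last exact: xJ.
apply: contraLR; rewrite -!pos_neg -(weyl_neg _ xW); apply: xJ.
by rewrite par_neg.
Qed.

Lemma inv_pos_on J x a : pos_on J x -> a \in inv x -> a \notin par J.
Proof. by move=> xJ /inv_setP[ap]; apply: contra => /xJ; apply. Qed.

Lemma pos_on_inv J x : (forall a, a \in inv x -> a \notin par J) -> pos_on J x.
Proof.
move=> H a aJ ap; apply: contraT => xa.
by rewrite (negPf (H a _)) // ?in_inv ?ap // in aJ. Qed.

Lemma inv_sub_mul_pos_on J u x : u \in weylJ D J -> x \in W -> pos_on J x ->
  inv u \subset inv (u * x)%g.
Proof.
move=> uJ xW xJ; apply/subsetP => a au; have aJ := subsetP (inv_weylJ uJ) a au.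
by move: au; rewrite !in_inv permM (pos_onE xW xJ) // par_weylJ.
Qed.

Lemma len_mul_pos_on J u x : u \in weylJ D J -> x \in W -> pos_on J x ->
  len D (u * x)%g = (len D u + len D x)%N.
Proof.
move=> uJ xW xJ; have uW := weylJ_W uJ.
rewrite (len_inv_sub uW) ?groupM // ?(inv_sub_mul_pos_on uJ) //.
by rewrite mulKg.
Qed.

(** If [x] made some [alpha s] with [s] in [J] negative, [refl s * x] would be a shorter element of
    the coset. Conversely [len_mul_pos_on] makes lengths add along the coset. *)
Lemma min_repsP J K x : J \subset K ->
  reflect (x \in weylJ D K /\ pos_on J x) (x \in min_reps D J K).
Proof.
move=> JK; rewrite in_set; apply: (iffP exists_inP).
  case=> C /rcosetsP[y yK ->] /andP[xy /forall_inP xmin].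
  have xK : x \in weylJ D K.
    case/rcosetP: xy => u uJ ->; rewrite groupM //.
    exact: subsetP (weylJS _ JK) _ uJ.
  split=> //; apply: pos_on_simple => [|s sJ]; first exact: weylJ_W xK.
  apply: contraT => xs; have := xmin (refl s * x)%g.
  rewrite (len_refl_mul_neg (weylJ_W xK) xs) ltnn; apply.
  case/rcosetP: xy => u uJ ->; rewrite mulgA mem_rcoset mulgK groupM //.
  exact: refl_weylJ.
case=> xK xJ; exists (weylJ D J :* x)%g; first by apply/rcosetsP; exists x.
rewrite rcoset_refl /=; apply/forall_inP => _ /rcosetP[u uJ ->].
by rewrite (len_mul_pos_on uJ) ?(weylJ_W xK) // leq_addl.
Qed.

Lemma rep_rightP J K w : J \subset K -> w \in weylJ D K ->
  [/\ rep_right D J K w \in weylJ D K, pos_on J (rep_right D J K w)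
    & rep_left D J K w \in weylJ D J].
Proof.
move=> JK wK; rewrite /rep_left.
(* [repr] picks an element of the intersection only if there is one; a shortest element of the coset
   is such an element. *)
have : rep_right D J K w \in (weylJ D J :* w :&: min_reps D J K)%g.
  case: (arg_minnP (P := mem (weylJ D J :* w)%g) (len D)
    (rcoset_refl (weylJ D J) w)) => x xw xmin.
  apply: (mem_repr x); rewrite in_setI; apply/andP; split=> //.
  rewrite in_set; apply/exists_inP; exists (weylJ D J :* w)%g.
    by apply/rcosetsP; exists w.
  by apply/andP; split=> //; apply/forall_inP.
rewrite in_setI => /andP[xw /(min_repsP _ JK)[xK xJ]]; split=> //.
by rewrite -groupV invMg invgK -mem_rcoset.
Qed.

(** Local maximality suffices: whenever [m^-1 (alpha s)] is positive it must lie in [par J], since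
    otherwise [m * refl s] is a longer representative. This serves both the top representatives and
    the longest element. *)
Lemma inv_set_maximal J K m : m \in weylJ D K -> pos_on J m ->
  (forall s, s \in K -> pos_on J (m * refl s)%g ->
     (len D (m * refl s)%g <= len D m)%N) ->
  inv m = [set a in pos | (a \in par K) && (a \notin par J)].
Proof.
move=> mK mJ mmax; have mW := weylJ_W mK; apply/eqP; rewrite eqEsubset.
apply/andP; split; apply/subsetP => a.
  move=> am; have aJ := inv_pos_on mJ am; have aK := subsetP (inv_weylJ mK) a am.
  by case/inv_setP: am => ap _; rewrite in_set ap aK.
have {}mmax s : s \in K ->
    (m^-1%g (alpha s) \in pos) -> m^-1%g (alpha s) \in par J.
  move=> sK sp; apply: contraT => sJ; have := mmax s sK.
  rewrite len_mul_refl // ltnn; apply; apply: pos_on_inv => b.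
  by rewrite inv_set_mul_refl // in_setU1 => /predU1P[-> //|/(inv_pos_on mJ)].
rewrite in_set in_inv => /and3P[ap aK aJ]; rewrite ap /=; apply/negP => map_.
(* A positive [m a] is a nonnegative combination of the [alpha j] with [j] in [K]. Applying [m^-1],
   whose values there have coordinates at most 0 off [J], shows that the coordinates of [a] off [J]
   vanish. *)
case/negP: aJ; apply/parP => s sJ; apply/eqP; rewrite eq_le.
have /posP-> := ap; rewrite andbT -[a](permK m) co_weyl ?groupV //.
apply: sumr_le0 => j _; have [jK|jK] := boolP (j \in K); last first.
  by move: aK; rewrite -(par_weylJ _ mK) => /parP/(_ j jK)->; rewrite mul0r.
rewrite mulr_ge0_le0 //; first by have /posP := map_.
have [/(mmax j jK)/parP/(_ s sJ)->|] // := boolP (m^-1%g (alpha j) \in pos).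
by rewrite -pos_neg => /posP/(_ s); rewrite co_neg oppr_ge0.
Qed.

Lemma top_repP J K : J \subset K ->
  [/\ top_rep D J K \in weylJ D K, pos_on J (top_rep D J K)
    & inv (top_rep D J K) = [set a in pos | (a \in par K) && (a \notin par J)]].
Proof.
move=> JK; rewrite /top_rep.
have m1 : (1%g : {perm Phi}) \in min_reps D J K.
  by apply/min_repsP => //; split; rewrite ?group1 // => a _; rewrite perm1.
case: arg_maxnP => // m /(min_repsP _ JK)[mK mJ] mmax; split=> //.
apply: inv_set_maximal => // s sK sJ; apply: mmax; apply/min_repsP => //; split=> //.
by rewrite groupM // refl_weylJ.
Qed.

Lemma longest_elementP : longest_element D \in W /\ inv (longest_element D) = pos.
Proof.
rewrite /longest_element; case: arg_maxnP => [|m mW mmax]; first exact: group1.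
(* The longest element is the case of the trivial parabolic inside the whole group. *)
split=> //; rewrite (@inv_set_maximal set0 setT) //.
- by apply/setP => a; rewrite in_set par_setT par_set0 /= andbT.
- by move=> a; rewrite (negPf (par_set0 a)).
by move=> s sK _; apply: mmax; rewrite groupM // refl_weylJ.
Qed.

(** The simple root of the first letter is an inversion of [w], hence lies in [par K]; then recurse
    on the tail. *)
Lemma reduced_letters K t w : w \in weylJ D K -> reduced_word D t w -> all (mem K) t.
Proof.
elim: t w => // s t IH w wK /andP[/eqP wE /eqP st] /=.
have wW := weylJ_W wK; have ws : w (alpha s) \notin pos.
  apply/negP => ws; have := len_refl_mul_pos wW ws.
  rewrite -st -wE word_prod_cons mulgA reflection_invol mul1g => E.
  by have := len_le D t; rewrite E /= => /ltnW; rewrite ltnn.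
have sK : s \in K.
  rewrite -par_simpleE; apply: (subsetP (inv_weylJ wK)).
  by rewrite in_inv pos_simple ws.
rewrite sK (IH (refl s * w)%g) ?groupM ?refl_weylJ // /reduced_word.
have := len_refl_mul_neg wW ws; rewrite -st => -[->].
by rewrite -wE word_prod_cons mulgA reflection_invol mul1g !eqxx.
Qed.

End Parabolic.

(** * Minuscule cosets and greedy subwords *)

Section Greedy.
Local Open Scope ring_scope.
Variables (R : realFieldType) (n : nat) (X : rootSystem R n).
Variables (r : nat) (D : simpleSystem X r).
Local Notation Phi := (root_fset X).
Local Notation alpha := (simple D).
Local Notation pos := (pos_roots D).
Local Notation par := (parabolic_roots D).
Local Notation refl s := (reflection (alpha s)).
Local Notation co := (root_coord D).
Local Notation neg := (@neg_root R n X).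
Local Notation inv := (inv_set D).
Local Notation W := (weyl D).
Local Notation wp := (word_prod D).
Implicit Types (s : 'I_r) (t om : seq 'I_r) (v w u : {perm Phi}).

(** In the component of [alpha s] the coordinate is a natural number bounded by that of the maximal
    root, namely 1. A root outside that component has coordinate 0. *)
Lemma minuscule_co (K : {set 'I_r}) s (a : Phi) :
  minuscule D K s -> a \in par K -> a \in pos -> co s a = 0 \/ co s a = 1.
Proof.
case=> A [theta [[AK _ orthA] sA [_ thmax] th1]] aK ap.
have [aA|aA] := boolP (a \in A); last first.
  left; have orth i : alpha i \in A -> dotv (val (alpha i)) (val a) = 0.
    by move=> iA; apply: orthA; rewrite // inE aA.
  pose c i := if alpha i \in A then co i a else 0.
  (* Split [a] into a combination [u] of simple roots in [A] and a remainder [v]. Both [a] and [v]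
     are orthogonal to [u], so [u] is orthogonal to itself and vanishes. *)
  pose d i := if alpha i \in A then 0 else co i a.
  pose u := \sum_i c i *: val (alpha i); pose v := \sum_i d i *: val (alpha i).
  have aE : val a = u + v.
    rewrite {1}(co_expand D a) -big_split /=; apply: eq_bigr => i _.
    by rewrite -scalerDl /c /d; case: ifP; rewrite ?addr0 ?add0r.
  have vu : dotv v u = 0.
    rewrite dotv_suml big1 // => i _; rewrite dotvZl /d.
    case: ifPn => iA; rewrite ?mul0r //.
    have [iK|/(parP _ _ _ aK)->] := boolP (i \in K); last by rewrite mul0r.
    rewrite dotvC dotv_suml big1 ?mulr0 // => j _; rewrite dotvZl /c.
    case: ifP => jA; rewrite ?mul0r // orthA ?mulr0 // inE iA.
    exact: par_simple.
  have uu : dotv u u = 0.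
    have : dotv u (val a) = 0.
      rewrite dotv_suml big1 // => i _; rewrite dotvZl /c.
      by case: ifP => [/orth->|]; rewrite ?mulr0 ?mul0r.
    by rewrite dotvC aE dotvDl vu addr0.
  have u0 : u = 0.
    by apply/eqP; apply: contraT => /dotv_gt0; rewrite uu ltxx.
  by have := co_sum D s c; rewrite [X in coord _ _ X]u0 linear0 /c sA => a0; apply: esym.
have : co s a <= 1.
  rewrite -th1 -subr_ge0 -/(co _ _) /root_coord -linearB.
  have [|c c0 ->] := thmax a; first by rewrite in_setI aA ap.
  rewrite linear_sum; apply: sumr_ge0 => g /setIP[_ gp] /=.
  by rewrite linearZ /= mulr_ge0 //; have /posP := gp; apply.
have [k ->] := co_nat s ap; rewrite -[X in _ <= X]/(1%:R) ler_nat.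
by case: k => [|[|k]] // _; [left|right].
Qed.

(** * Roots of [K] outside [J] for a minuscule maximal parabolic *)

Section Minuscule.
Variables (J K : {set 'I_r}) (s0 : 'I_r).
Hypotheses (KE : K = s0 |: J) (s0K : minuscule D K s0).

Let co_pos (a : Phi) : a \in par K -> a \in pos -> a \notin par J -> co s0 a = 1.
Proof.
move=> aK ap; have [a0|//] := minuscule_co s0K aK ap; case/parP => s sJ.
have [->//|ss] := eqVneq s s0; apply: (parP _ _ _ aK).
by rewrite KE in_setU1 (negPf ss).
Qed.

Let co_par (a : Phi) : a \in par K -> co s0 a = 0 -> a \in par J.
Proof.
move=> aK a0; apply/parP => s sJ.
have [->//|ss] := eqVneq s s0; apply: (parP _ _ _ aK).
by rewrite KE in_setU1 (negPf ss).
Qed.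

Let co_abs (a : Phi) : a \in par K -> [\/ co s0 a = 0, co s0 a = 1 | co s0 a = -1].
Proof.
move=> aK; case/orP: (pos_or_neg D a) => ap.
  by have [->|->] := minuscule_co s0K aK ap; [constructor 1|constructor 2].
have := minuscule_co s0K _ ap; rewrite par_neg co_neg => /(_ aK)[] E.
  by constructor 1; apply/eqP; rewrite -oppr_eq0 E.
by constructor 3; rewrite -E opprK.
Qed.

(** The reflection of [a] in [b] has coordinate [1 - pairing (val a) (val b)] at [s0]. Being 0, 1 or
    -1, it leaves 1, 0 or 2 for the pairing. *)
Let pairing_coset (a b : Phi) : a \in par K -> a \in pos -> a \notin par J ->
  b \in par K -> b \in pos -> b \notin par J ->
  [\/ dotv (val a) (val b) = 0,
      exists2 e, e \in par J & val a = val b + val e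
    | 2%:R * dotv (val a) (val b) = 2%:R * dotv (val b) (val b)].
Proof.
move=> aK ap aJ bK bp bJ; set c := reflection b a.
have cK : c \in par K.
  apply/parP => s sK; rewrite co_reflection.
  by rewrite (parP _ _ _ aK) // (parP _ _ _ bK) // mulr0 subr0.
have := co_abs cK; rewrite co_reflection !co_pos // mulr1 => -[] E.
- have k1 : pairing (val a) (val b) = 1 by rewrite -[LHS]opprK -[- _]add0r; lra.
  constructor 2; exists c; last by rewrite val_reflection k1 scale1r addrC subrK.
  by apply: co_par => //; rewrite co_reflection !co_pos // k1 mulr1 subrr.
- have : pairing (val a) (val b) = 0 by lra.
  move/eqP; rewrite /pairing !mulf_eq0 invr_eq0 (negPf (dotv_root_neq0 b)) orbF.
  by rewrite pnatr_eq0 /= => /eqP; constructor 1.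
have k2 : pairing (val a) (val b) = 2%:R by lra.
by constructor 3; rewrite -[in RHS]k2 /pairing divfK // dotv_root_neq0.
Qed.

Lemma minuscule_orth (a b : Phi) : a \in par K -> a \in pos -> a \notin par J ->
  b \in par K -> b \in pos -> b \notin par J -> a != b ->
  dotv (val a) (val b) = 0 \/ exists2 e, e \in par J & val a = val b + val e.
Proof.
move=> aK ap aJ bK bp bJ ab.
have [?|?|ab2] := pairing_coset aK ap aJ bK bp bJ; [by left|by right|].
have [E|[e eJ E]|ba2] := pairing_coset bK bp bJ aK ap aJ.
- by left; rewrite dotvC.
- by right; exists (neg e); rewrite ?par_neg // val_neg_root E addrK.
(* Both pairings are 2, so the squared norm of [val a - val b] is 0. *)
case/negP: ab; rewrite -val_eqE -subr_eq0; apply: contraT => /dotv_gt0.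
rewrite dotvBl !dotvBr; rewrite (dotvC (val b)) in ba2 *.
by move=> H; exfalso; move: ab2 ba2 H; lra.
Qed.

(** If [x b] were positive, so would be [x a = x b + x e], because [x] keeps the positive roots of
    [J] positive. *)
Lemma inv_set_ideal x (a b e : Phi) : x \in W -> pos_on D J x ->
  a \in inv x -> b \in pos -> e \in par J -> e \in pos ->
  val a = val b + val e -> b \in inv x.
Proof.
move=> xW xJ /inv_setP[ap xa] bp eJ ep abe; rewrite in_inv bp /=.
apply: contra xa => /posP xb; have /posP xe := xJ e eJ ep.
have [M xM] := weyl_linear xW; apply/posP => s.
by rewrite /root_coord xM abe mulmxDl -!xM linearD addr_ge0 //; [exact: xb|exact: xe].
Qed.

Section Meet.
Variable x : {perm Phi}.
Hypotheses (xK : x \in weylJ D K) (xJ : pos_on D J x).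

(** Otherwise [g] and [d] differ by a root [e] of [J]. According to the sign of [e], [inv_set_ideal]
    puts [d] into [inv x] or [g] into [inv b]. *)
Lemma inv_setD_orth b (g d : Phi) : b \in weylJ D K -> pos_on D J b ->
  g \in inv x -> g \notin inv b -> d \in inv b -> d \notin inv x ->
  dotv (val g) (val d) = 0.
Proof.
move=> bK bJ gx gb db dx.
have gK := subsetP (inv_weylJ xK) g gx; have dK := subsetP (inv_weylJ bK) d db.
have gJ := inv_pos_on xJ gx; have dJ := inv_pos_on bJ db.
have [gp _] := inv_setP _ _ _ gx; have [dp _] := inv_setP _ _ _ db.
have gd : g != d by apply: contraNneq gb => ->.
have [//|[e eJ E]] := minuscule_orth gK gp gJ dK dp dJ gd.
case/orP: (pos_or_neg D e) => ep.
  by rewrite (inv_set_ideal (weylJ_W xK) xJ gx dp eJ ep) in dx.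
rewrite (inv_set_ideal (weylJ_W bK) bJ db gp _ ep) ?par_neg // in gb.
by rewrite val_neg_root E addrK.
Qed.

(* Going up from a to b in weak order one crosses only roots of [inv b]
   outside [inv x], and these are orthogonal to g. *)
Lemma agree_off_meet a b (g : Phi) : a \in W -> b \in weylJ D K ->
  pos_on D J b -> inv x :&: inv b \subset inv a -> inv a \subset inv b ->
  g \in inv x -> g \notin inv b -> a g = b g.
Proof.
move=> aW bK bJ xba ab gx gb; have bW := weylJ_W bK.
move: {2}(#|_|) (leqnn #|inv b :\: inv a|) => k.
elim: k a aW xba ab => [|k IH] a aW xba ab.
  rewrite leqn0 cards_eq0 setD_eq0 => ba; congr (fun_of_perm _ g).
  by apply: (@inv_set_inj _ _ _ _ D) => //; apply/eqP; rewrite eqEsubset ab.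
move=> cardk; pose c := (a^-1 * b)%g; have cW : c \in W by rewrite groupM ?groupV.
have [/existsP[s cs]|] := boolP [exists s, c (alpha s) \notin pos]; last first.
  rewrite negb_exists => /forallP cpos; suff c1 : c = 1%g.
    by rewrite -[b](mulKVg a) -/c c1 mulg1.
  apply: (@inv_set_inj _ _ _ _ D) => //; rewrite inv_set1; apply/setP => d.
  rewrite in_set0; apply/negP => /inv_setP[dp /negP[]].
  apply: (@pos_on_simple _ _ _ _ _ setT) => // [s _|]; last exact: par_setT.
  by have := cpos s; rewrite negbK.
(* [d] is the root added by the weak order step from [a] to [a * refl s], which stays below [b]. *)
pose d := (a^-1)%g (alpha s); have bd : b d = c (alpha s) by rewrite permM.
have ad : a d = alpha s by rewrite permKV.
have dp : d \in pos.
  apply: contraT => dn; have : neg d \in inv b.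
    apply: (subsetP ab); rewrite in_inv pos_neg dn (weyl_neg _ aW) ad.
    by rewrite pos_neg pos_simple.
  by rewrite in_inv (weyl_neg _ bW) pos_neg dn pos_neg bd (negPf cs).
have db : d \in inv b by rewrite in_inv dp bd.
have da : d \notin inv a by rewrite in_inv ad pos_simple andbF.
have dx : d \notin inv x.
  by apply: contra da => dx; apply: (subsetP xba); rewrite in_setI dx.
have asE := inv_set_mul_refl aW dp.
have sW : refl s \in W by rewrite refl_weylJ ?inE.
rewrite -(IH (a * refl s)%g) ?groupM ?asE //.
(* [a] preserves the inner product, so [a g] is orthogonal to [a d = alpha s] and [refl s] fixes
   it. *)
- rewrite permM reflection_fix // -ad (weyl_dotv _ _ aW).
  exact: (inv_setD_orth bK bJ).
- exact: subset_trans xba (subsetU1 _ _).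
- by apply/subUsetP; rewrite sub1set.
rewrite -ltnS; apply: leq_trans cardk; apply: proper_card.
apply/properP; split; first exact/setDS/subsetU1.
by exists d; rewrite in_setD ?in_setU1 ?eqxx ?da.
Qed.

End Meet.
End Minuscule.

Lemma len_mul_word_le w t : w \in W -> (len D (w * wp t)%g <= len D w + size t)%N.
Proof.
by case/len_word => t' <- <-; rewrite -word_prod_cat -size_cat len_le.
Qed.

Lemma inv_sub_mul_word w t : w \in W ->
  len D (w * wp t)%g = (len D w + size t)%N -> inv w \subset inv (w * wp t)%g.
Proof.
move=> wW lw; rewrite -right_weak_leE ?groupM ?word_weyl // /right_weak_le.
rewrite mulKg eqn_leq lw !leq_add2l len_le andbT.
have [t' E <-] := len_word (word_weyl D t).
by rewrite -(leq_add2l (len D w)) -lw -E len_mul_word_le.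
Qed.

Lemma mul_word_cons w s t : w \in W ->
  len D (w * wp (s :: t))%g = (len D w + size (s :: t))%N ->
  w^-1%g (alpha s) \in pos /\
  len D (w * refl s * wp t)%g = (len D (w * refl s)%g + size t)%N.
Proof.
move=> wW; rewrite word_prod_cons mulgA /= => lw.
have sW : refl s \in W by rewrite refl_weylJ ?inE.
have ws : w^-1%g (alpha s) \in pos.
  apply: contraT => ws; have := len_mul_word_le t (groupM wW sW).
  by rewrite lw (len_mul_refl_neg wW ws) !addnS ltnNge addSn ltnW.
by split=> //; rewrite lw len_mul_refl // addSnnS.
Qed.

(** A letter is taken exactly when it can begin a reduced word of what remains to be written; [w] is
    that remaining element. *)
Fixpoint greedy om w : bitseq :=
  if om is s :: om' then
    if w (alpha s) \in pos then false :: greedy om' w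
    else true :: greedy om' (refl s * w)%g
  else [::].

(** When the lengths add, these are the inversions gained letter by letter in extending [w] along
    [om]. *)
Fixpoint word_roots w om : seq Phi :=
  if om is s :: om' then w^-1%g (alpha s) :: word_roots (w * refl s)%g om'
  else [::].

Lemma size_greedy om w : size (greedy om w) = size om.
Proof. by elim: om w => //= s om IH w; case: ifP => _ /=; rewrite IH. Qed.

Lemma mem_word_roots w om (a : Phi) : w \in W ->
  len D (w * wp om)%g = (len D w + size om)%N ->
  (a \in inv (w * wp om)%g) = (a \in inv w) || (a \in word_roots w om).
Proof.
elim: om w => [|s om IH] w wW /= lw; first by rewrite word_prod0 mulg1 orbF.
have sW : refl s \in W by rewrite refl_weylJ ?inE.
have [ws lws] := mul_word_cons wW lw.
rewrite word_prod_cons mulgA IH ?groupM // inv_set_mul_refl // in_setU1 in_cons.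
by rewrite orbA [(a == _) || _]orbC.
Qed.

(** Induction along the word: [b] is the product of all letters read, [a] that of the letters taken,
    and the invariant is [inv a = inv x :&: inv b]. The next letter is taken exactly when the root
    it adds to [inv b] lies in [inv x]. *)
Lemma greedy_meet (J K : {set 'I_r}) s0 om a b x :
  K = s0 |: J -> minuscule D K s0 ->
  x \in weylJ D K -> pos_on D J x ->
  a \in W -> b \in weylJ D K -> all (mem K) om -> pos_on D J (b * wp om)%g ->
  len D (b * wp om)%g = (len D b + size om)%N ->
  inv x :&: inv b = inv a ->
  let m := greedy om (a^-1 * x)%g in
  m = [seq c \in inv x | c <- word_roots b om] /\
  inv (a * wp (mask m om))%g = inv x :&: inv (b * wp om)%g.
Proof.
move=> KE s0K xK xJ; elim: om a b => [|s om IH] a b aW bK /=.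
  by move=> _ _ _ E; rewrite !word_prod0 !mulg1 E.
case/andP=> sK omK bomJ lb xba; have bW := weylJ_W bK; have xW := weylJ_W xK.
have sW : refl s \in W by rewrite refl_weylJ ?inE.
have sKW : refl s \in weylJ D K by rewrite refl_weylJ.
have bJ : pos_on D J b.
  apply: pos_on_inv => c /(subsetP (inv_sub_mul_word bW lb)).
  exact: (inv_pos_on bomJ).
have [bs lbs] := mul_word_cons bW lb.
move: bomJ; rewrite word_prod_cons mulgA => bomJ.
set c := b^-1%g (alpha s); have bc : b c = alpha s by rewrite permKV.
have cb : c \notin inv b by rewrite in_inv bc pos_simple andbF.
have bsE := inv_set_mul_refl bW bs.
have xa : inv a \subset inv x by rewrite -xba subsetIl.
have ab : inv a \subset inv b by rewrite -xba subsetIr.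
have agree g : g \in inv x -> g \notin inv b -> a g = b g.
  by apply: (agree_off_meet KE s0K xK xJ aW bK bJ) => //; rewrite xba.
(* If [c] lies in [inv x], then [a] and [b] agree on it, so the letter adds the same root [c] to
   [inv a]. *)
rewrite permM; have [cx|cx] := boolP (c \in inv x).
  have ac : a^-1%g (alpha s) = c by rewrite -bc -agree ?permK.
  have [cp xc] := inv_setP _ _ _ cx; rewrite ac (negPf xc).
  have -> : (refl s * (a^-1 * x) = (a * refl s)^-1 * x)%g.
    rewrite invMg mulgA; congr (_ * _ * _)%g; apply/eqP.
    by rewrite eq_sym eq_invg_mul reflection_invol.
  have [|E1 E2] := IH (a * refl s)%g (b * refl s)%g (groupM aW sW)
    (groupM bK sKW) omK bomJ lbs.
    rewrite bsE inv_set_mul_refl ?ac // setIUr xba; congr (_ :|: _).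
    by apply/setIidPr; rewrite sub1set.
  by rewrite -E1 word_prod_cons mulgA; split.
(* If the letter were taken, the root [g] it adds to [inv a] would be in [inv x] but not in [inv b].
   Then [b g = a g = alpha s], so [g] would be [c], contrary to [cx]. *)
have -> : x (a^-1%g (alpha s)) \in pos.
  apply: contraT => xg; set g := a^-1%g (alpha s) in xg.
  have ag : a g = alpha s by rewrite permKV.
  have gp : g \in pos.
    apply: contraT => gn; have : neg g \in inv x.
      apply: (subsetP xa); rewrite in_inv pos_neg gn (weyl_neg _ aW) ag.
      by rewrite pos_neg pos_simple.
    by rewrite in_inv (weyl_neg _ xW) !pos_neg (negPf xg) andbF.
  have gx : g \in inv x by rewrite in_inv gp.
  have gb : g \notin inv b.
    apply/negP => gb; have : g \in inv a by rewrite -xba in_setI gx.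
    by rewrite in_inv ag pos_simple andbF.
  by case/negP: cx; rewrite /c -ag agree // permK.
have [|E1 E2] := IH a (b * refl s)%g aW (groupM bK sKW) omK bomJ lbs.
  rewrite bsE setIUr xba (_ : _ :&: [set _] = set0) ?set0U //.
  apply/setP => d; rewrite in_setI in_set1 in_set0 andbC.
  by case: eqP => // ->; apply: negbTE.
by rewrite -E1; split.
Qed.

Lemma greedy_cat om1 om2 w : greedy (om1 ++ om2) w =
  greedy om1 w ++ greedy om2 ((wp (mask (greedy om1 w) om1))^-1 * w)%g.
Proof.
elim: om1 w => [|s om1 IH] w /=; first by rewrite word_prod0 invg1 mul1g.
case: ifP => _; rewrite /= IH //; congr (_ :: _ ++ greedy _ _).
rewrite word_prod_cons invMg -!mulgA; congr (_ * _)%g.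
by congr (_ * _)%g; apply/eqP; rewrite eq_sym eq_invg_mul reflection_invol.
Qed.

(** While letters from [J] are read, the roots tested stay in [par J], where [x] preserves signs, so
    [x] is invisible to the greedy choice. *)
Lemma greedy_mul (J : {set 'I_r}) om u x : all (mem J) om ->
  u \in weylJ D J -> x \in W -> pos_on D J x ->
  greedy om (u * x)%g = greedy om u.
Proof.
move=> omJ uJ xW xJ; elim: om u omJ uJ => //= s om IH u /andP[sJ omJ] uJ.
rewrite permM (pos_onE xW xJ) ?par_weylJ ?par_simple //.
by case: ifP => _; rewrite -?mulgA ?mulgA IH // groupM // refl_weylJ.
Qed.

(** Inclusion of position sets, for masks of equal size; [zip] truncates the longer one
    otherwise. *)
Definition submask (m1 m2 : bitseq) := all (fun b => b.1 ==> b.2) (zip m1 m2).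

Lemma submask_map (T : Type) (f g : pred T) (t : seq T) :
  submask (map f t) (map g t) = all (fun y => f y ==> g y) t.
Proof. by elim: t => //= y t <-. Qed.

Lemma submask_cat m1 m2 m3 m4 : size m1 = size m3 ->
  submask (m1 ++ m2) (m3 ++ m4) = submask m1 m3 && submask m2 m4.
Proof. by move=> E; rewrite /submask zip_cat // all_cat. Qed.

(** Induction on [q]. Because of [rev], the block of the head [s0] comes last, after the word of the
    smaller parabolic. The auxiliary conclusions say that [om] is a reduced word of the longest
    element for [K] and that its greedy subword for [w] does spell [w]. *)
Lemma middle_le_greedy (q : seq 'I_r) (oms : seq (seq 'I_r)) :
  size oms = size q ->
  (forall k s0, k < size q ->
     minuscule D [set s in drop k q] (nth s0 q k))%N ->
  (forall k, k < size q ->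
     reduced_word D (nth [::] oms k)
       (top_rep D [set s in drop k.+1 q] [set s in drop k q]))%N ->
  let K := [set s in q] in let om := flatten (rev oms) in
  [/\ all (mem K) om,
      inv (wp om) = [set a in pos | a \in par K],
      len D (wp om) = size om,
      forall w, w \in weylJ D K -> wp (mask (greedy om w) om) = w
    & forall v w, v \in weylJ D K -> w \in weylJ D K ->
        middle_le D q v w = submask (greedy om v) (greedy om w)].
Proof.
elim: q oms => [|s0 q IH] [|om1 oms] //= => [_ _ _|[sz] qmin qred].
  have E : [set s in [::] : seq 'I_r] = set0 by apply/setP => s; rewrite !inE.
  have W1 w : w \in weylJ D [set s in [::]] -> w = 1%g.
    by rewrite E /= imset0 gen0 => /set1P.
  split=> //; rewrite ?word_prod0 ?len1 //.
    rewrite inv_set1; apply/setP => a; rewrite in_set0 in_set E.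
    by rewrite (negPf (par_set0 _ _)) andbF.
    by move=> w /W1->.
  by move=> v w /W1-> /W1->; rewrite eqxx.
set J := [set s in q]; set K := [set s in s0 :: q].
have KE : K = s0 |: J by apply/setP => s; rewrite !inE.
have JK : J \subset K by rewrite KE subsetU1.
have s0K : minuscule D K s0 by apply: (qmin 0%N s0).
have [||omJ om_inv lenom om_ok om_le] := IH oms sz.
- by move=> k s1 kq; apply: (qmin k.+1 s1).
- by move=> k kq; apply: (qred k.+1).
have [mK mJ minv] := top_repP D JK.
have := qred 0%N isT; rewrite /= drop0 -/J -/K.
set m := top_rep D J K in mK mJ minv *; move=> red1.
have om1K := reduced_letters mK red1.
case/andP: red1 => /eqP mE /eqP msz.
rewrite rev_cons flatten_rcons.
set om := flatten (rev oms) in omJ om_inv lenom om_ok om_le *.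
have omK : all (mem K) om by apply: sub_all omJ => s; apply: subsetP.
have um : wp om \in weylJ D J := word_weylJ D omJ.
have mW := weylJ_W mK.
(* [greedy_meet] started at [a = b = 1]; at the end the meet with [inv m] is all of [inv x], since
   [m] inverts every positive root of [K] outside [J]. *)
have block x : x \in weylJ D K -> pos_on D J x ->
    greedy om1 x = [seq c \in inv x | c <- word_roots 1%g om1] /\
    wp (mask (greedy om1 x) om1) = x.
  move=> xK xJ; have := @greedy_meet J K s0 om1 1%g 1%g x KE s0K xK xJ.
  rewrite !group1 !mul1g invg1 mul1g mE len1 add0n inv_set1 setI0.
  case=> // E1 E2; split=> //.
  apply: (@inv_set_inj _ _ _ _ D); rewrite ?word_weyl ?(weylJ_W xK) //.
  rewrite -[X in inv X = _]mul1g E2 ?mul1g.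
  apply/setIidPl/subsetP => a ax; rewrite minv in_set (inv_pos_on xJ ax).
  by rewrite (subsetP (inv_weylJ xK)) //; case/inv_setP: ax => ->.
have split_greedy w : w \in weylJ D K ->
    let u := rep_left D J K w in let x := rep_right D J K w in
    greedy (om ++ om1) w = greedy om u ++ greedy om1 x.
  move=> wK u x; have [xK xJ uJ] := rep_rightP JK wK.
  rewrite greedy_cat -[w](mulgKV x) -/u.
  by rewrite (greedy_mul omJ uJ (weylJ_W xK) xJ) (om_ok _ uJ) mulKg.
split.
- by rewrite all_cat omK.
- rewrite word_prod_cat mE; apply/setP => a; rewrite in_inv permM in_set.
  (* On positive roots of [J] the prefix does the inverting and [m] keeps the signs; other roots
     keep their sign and stay outside [par J] under the prefix, and [m] inverts those of [K]. *)
  case: (boolP (a \in pos)) => //= ap; have [aJ|aJ] := boolP (a \in par J).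
    rewrite (subsetP (parS D JK)) // (pos_onE mW mJ) ?par_weylJ //.
    by have := in_inv D (wp om) a; rewrite om_inv in_set ap aJ /= => <-.
  have := in_inv D m (wp om a); rewrite minv in_set (pos_weylJ um) // ap /= => <-.
  by rewrite (par_weylJ _ um) aJ andbT (par_weylJ _ (subsetP (weylJS D JK) _ um)).
- by rewrite word_prod_cat mE (len_mul_pos_on um) // lenom size_cat msz.
- move=> w wK; have [xK xJ uJ] := rep_rightP JK wK.
  rewrite split_greedy // mask_cat ?size_greedy // word_prod_cat.
  by rewrite (om_ok _ uJ) (block _ xK xJ).2 mulgKV.
move=> v w vK wK; have [xK xJ uJ] := rep_rightP JK vK.
have [yK yJ tJ] := rep_rightP JK wK.
rewrite !split_greedy // submask_cat ?size_greedy // om_le //; congr (_ && _).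
rewrite right_weak_leE ?(weylJ_W xK) ?(weylJ_W yK) //.
rewrite (block _ xK xJ).1 (block _ yK yJ).1 submask_map.
(* The roots read along [om1] exhaust [inv m], so comparing the two masks tests every possible
   inversion of a representative. *)
have roots c : (c \in inv m) = (c \in word_roots 1%g om1).
  have := @mem_word_roots 1%g om1 c (group1 _).
  by rewrite mul1g mE len1 add0n inv_set1 in_set0; apply.
apply/subsetP/allP => H c.
  by move=> _; apply/implyP/H.
move=> cx; apply: (implyP (H c _)) => //.
rewrite -roots minv in_set (inv_pos_on xJ cx) (subsetP (inv_weylJ xK)) //.
by case/inv_setP: cx => ->.
Qed.

End Greedy.

(** * Sorting sets *)

Section Sorting.
Variables (R : realFieldType) (n : nat) (X : rootSystem R n).
Variables (r : nat) (D : simpleSystem X r).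
Local Notation alpha := (simple D).
Local Notation W := (weyl D).
Local Notation wp := (word_prod D).
Implicit Types (om : seq 'I_r) (v w : {perm root_fset X}).

(** Each letter taken lowers the length of the remaining element by one, so a greedy subword that
    spells [w] is reduced. *)
Lemma size_mask_greedy om w : w \in W -> wp (mask (greedy D om w) om) = w ->
  size (mask (greedy D om w) om) = len D w.
Proof.
elim: om w => [|s om IH] w wW /=.
  by rewrite word_prod0 => <-; rewrite len1.
case: ifPn => ws /=; first exact: IH.
have sW : reflection (alpha s) \in W by rewrite refl_weylJ ?inE.
rewrite word_prod_cons (len_refl_mul_neg wW ws) => E.
rewrite IH ?groupM //.
by rewrite -[in RHS]E mulgA reflection_invol mul1g.
Qed.

(** If greedy skips a letter, no reduced word of [w] begins with it, so a competing mask skips it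
    too. If greedy takes a letter that the competitor skips, the competitor starts later. The list
    [t] stands for the positions, so that the induction can pass to tails. *)
Lemma greedy_lexi (d d' : Order.disp_t) (T : orderType d) om w m (t : seq T) :
  w \in W -> sorted <%O t -> size t = size om -> size m = size om ->
  wp (mask (greedy D om w) om) = w -> reduced_word D (mask m om) w ->
  ((mask (greedy D om w) t : seqlexi_with d' T) <= mask m t)%O.
Proof.
elim: om w m t => [|s om IH] w m t wW; first by case: t m => [|i t] // [].
case: t m => // i t [|b m] //= it [st] [sm].
have ti := order_path_min lt_trans it; have {}it := path_sorted it.
have sW : reflection (alpha s) \in W by rewrite refl_weylJ ?inE.
case: ifPn => ws /=.
  case: b => //= gw; last exact: IH.
  rewrite /reduced_word word_prod_cons /= => /andP[/eqP mw /eqP lw].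
  have := len_le D (mask m om).
  have -> : wp (mask m om) = (reflection (alpha s) * w)%g.
    by rewrite -mw mulgA reflection_invol mul1g.
  by rewrite (len_refl_mul_pos wW ws) -lw ltnNge leqnSn.
move=> gw; have {}gw : wp (mask (greedy D om (reflection (alpha s) * w)%g) om) =
    (reflection (alpha s) * w)%g.
  by rewrite -[in RHS]gw word_prod_cons mulgA reflection_invol mul1g.
have lw := len_refl_mul_neg wW ws.
case: b => /= red.
  rewrite lexi_cons !lexx /=; apply: IH => //; first exact: groupM.
  move: red; rewrite /reduced_word word_prod_cons lw => /andP[/eqP mw].
  by rewrite eqSS => ->; rewrite -mw mulgA reflection_invol mul1g eqxx.
(* The empty list would be lexicographically smallest; it is excluded because [w] has positive
   length. *)
case E: (mask m t) => [|j t'].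
  have : size (mask m t) = size (mask m om) by rewrite !size_mask ?sm ?st.
  by case/andP: red => _ /eqP->; rewrite E lw.
have ij : (i < j)%O.
  by apply: (allP ti); apply: (mem_mask (m := m)); rewrite E mem_head.
by rewrite lexi_cons (ltW ij) leNgt ij.
Qed.

(** * Translation between position sets and masks *)

Section Positions.
Variable om : seq 'I_r.

Definition position_mask (P : {set 'I_(size om)}) : bitseq :=
  [seq i \in P | i <- enum 'I_(size om)].

Definition mask_positions (m : bitseq) : {set 'I_(size om)} :=
  [set i : 'I_(size om) | nth false m i].

Lemma size_position_mask P : size (position_mask P) = size om.
Proof. by rewrite size_map size_enum_ord. Qed.

Lemma mask_positionsK m : size m = size om ->
  position_mask (mask_positions m) = m.
Proof.
move=> sm; rewrite /position_mask.
rewrite (eq_map (g := nth false m \o val)) => [|i]; last by rewrite inE.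
by rewrite map_comp val_enum_ord -sm -/(mkseq _ _) mkseq_nth.
Qed.

Lemma enum_position_mask (P : {set 'I_(size om)}) :
  enum P = mask (position_mask P) (enum 'I_(size om)).
Proof. by rewrite -filter_mask enumT. Qed.

Lemma subword_position_mask (P : {set 'I_(size om)}) : subword P = mask (position_mask P) om.
Proof. by rewrite /subword enum_position_mask map_mask map_tnth_enum. Qed.

Lemma sorting_set_greedy w : w \in W -> wp (mask (greedy D om w) om) = w ->
  sorting_set D om w = mask_positions (greedy D om w).
Proof.
move=> wW gw; set G := mask_positions _.
have GE : position_mask G = greedy D om w.
  by rewrite mask_positionsK // size_greedy.
have sorted_ord : sorted <%O (enum 'I_(size om)).
  by have := iota_ltn_sorted 0 (size om); rewrite -val_enum_ord sorted_map.
have Gmin P : reduced_word D (subword P) w ->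
    ((enum G : seqlexi 'I_(size om)) <= enum P)%O.
  rewrite subword_position_mask !enum_position_mask GE; apply: greedy_lexi => //.
  - by rewrite size_enum_ord.
  - exact: size_position_mask.
have Gred : reduced_word D (subword G) w.
  rewrite /reduced_word subword_position_mask GE gw eqxx /=.
  by rewrite size_mask_greedy.
(* The greedy set [G] is a minimiser, so the default [set0] never arises, and antisymmetry of the
   lexicographic order makes the chosen minimiser equal to it. *)
rewrite /sorting_set /Order.arg_min /extremum.
case: pickP => [P /andP[Pw /forallP Pmin]|/(_ G)] /=; last first.
  by rewrite Gred /=; case/negP; apply/forallP => P; apply/implyP/Gmin.
have : enum P = enum G.
  by apply: (@le_anti _ (seqlexi 'I_(size om))); rewrite Gmin // (implyP (Pmin G)).
by move=> E; apply/setP => i; rewrite -[LHS]mem_enum E mem_enum.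
Qed.

Lemma sorting_le_greedy v w : v \in W -> w \in W ->
  wp (mask (greedy D om v) om) = v -> wp (mask (greedy D om w) om) = w ->
  sorting_le D om v w = submask (greedy D om v) (greedy D om w).
Proof.
move=> vW wW gv gw; rewrite /sorting_le !sorting_set_greedy //.
rewrite -{2}(mask_positionsK (size_greedy D om v)).
rewrite -{2}(mask_positionsK (size_greedy D om w)) submask_map.
apply/subsetP/allP => [H i _|H i vi]; first exact/implyP/H.
by have /implyP := H i (mem_enum _ _); apply.
Qed.

End Positions.
End Sorting.

Theorem proposition8p1 (R : realFieldType) (n : nat) (X : rootSystem R n)
    (r : nat) (D : simpleSystem X r)
    (p : r.-tuple 'I_r) (p_perm : perm_eq p (enum 'I_r))
    (p_minuscule : forall k : 'I_r,
       minuscule D [set s in drop k p] (tnth p k))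
    (om : 'I_r -> seq 'I_r)
    (om_reduced : forall k : 'I_r,
       reduced_word D (om k)
         (top_rep D [set s in drop k.+1 p] [set s in drop k p])) :
  let omega := flatten (rev [seq om k | k <- enum 'I_r]) in
  reduced_word D omega (longest_element D) /\
  (forall v w : {perm root_fset X}, v \in weyl D -> w \in weyl D ->
     middle_le D p v w = sorting_le D omega v w).
Proof.
move=> omega.
have pT : [set s in p] = setT.
  by apply/setP => s; rewrite !inE (perm_mem p_perm) mem_enum.
have [||| _] := @middle_le_greedy R n X r D p [seq om k | k <- enum 'I_r].
- by rewrite size_map size_enum_ord size_tuple.
- move=> k s0; rewrite size_tuple => kr; have := p_minuscule (Ordinal kr).
  by rewrite (tnth_nth s0).
- move=> k; rewrite size_tuple => kr.
  rewrite (nth_map (Ordinal kr)) ?size_enum_ord //.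
  by rewrite (nth_ord_enum _ (Ordinal kr)); apply: (om_reduced (Ordinal kr)).
rewrite pT -/omega => om_inv lenom om_ok om_le; split; last first.
  move=> v w vW wW; rewrite om_le //.
  by rewrite sorting_le_greedy // om_ok.
have [lW linv] := longest_elementP D.
(* Both elements have all positive roots as inversions, so they coincide, and [lenom] gives
   reducedness. *)
rewrite /reduced_word; have -> : longest_element D = word_prod D omega.
  apply: (@inv_set_inj _ _ _ _ D) => //; first exact: word_weyl.
  by rewrite linv om_inv; apply/setP => a; rewrite in_set par_setT andbT.
by rewrite lenom !eqxx.
Qed.
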